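(* Let $\{X_n\}_{n\in\mathbb N}$ be a sequence of non-empty finite $T_0$ topological spaces (equivalently, finite posets), and let $\Delta=X_0\circledast X_1\circledast\cdots\circledast X_i\circledast X_{i+1}\circledast\cdots$. Then $\Delta$ is contractible.
   Context: A $T_0$ Alexandroff space (arbitrary intersections of open sets are open) is identified with a poset: $x\le y$ iff $U_x\subseteq U_y$, where $U_x$ is the minimal open set containing $x$; conversely a poset is given the topology whose open sets are the down-sets, and continuous maps are exactly order-preserving maps. The infinite non-Hausdorff join $X_0\circledast X_1\circledast\cdots$ is the disjoint union $\bigsqcup_i X_i$ with the given orders inside each $X_i$ and $x\le y$ whenever $x\in X_i$, $y\in X_j$ with $i<j$. $\mathbb N$ includes $0$. *)

(* Defs.v *)
From HB Require Import structures.
From mathcomp Require Import all_boot all_order all_algebra.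
From mathcomp Require Import all_classical all_reals all_analysis.
Import numFieldNormedType.Exports.
Set Implicit Arguments.
Unset Strict Implicit.
Unset Printing Implicit Defensive.

Local Open Scope classical_set_scope.
Local Open Scope ring_scope.

Definition minimal_open (T : topologicalType) (x : T) : set T :=
  \bigcap_(U in [set U : set T | open U /\ U x]) U.

Definition open_le (T : topologicalType) (x y : T) : Prop :=
  minimal_open x `<=` minimal_open y.

(* The carrier is a definition, so that it is a key of its own for canonical
   structures: {n & X n} already carries the disjoint-union topology. *)
Definition downset_space (T : Type) (le : T -> T -> Prop) : Type := T.

Section downset_topology.
Variables (T : Type) (le : T -> T -> Prop).

Definition is_downset (U : set T) : Prop :=
  forall x y : T, le x y -> U y -> U x.

Let downsetT : is_downset setT.
Proof. by []. Qed.

Let downsetI : setI_closed is_downset.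
Proof. by move=> U V dU dV x y xy [Uy Vy]; split; [exact: dU Uy|exact: dV Vy]. Qed.

Let downset_bigcup (I : Type) (f : I -> set T) :
  (forall i, is_downset (f i)) -> is_downset (\bigcup_i f i).
Proof. by move=> df x y xy [i _ fiy]; exists i => //; exact: df fiy. Qed.

HB.instance Definition _ := gen_eqMixin (downset_space le).
HB.instance Definition _ := gen_choiceMixin (downset_space le).
HB.instance Definition _ := @isOpenTopological.Build (downset_space le)
  is_downset downsetT downsetI downset_bigcup.

End downset_topology.

Inductive join_le (X : nat -> Type) (le : forall n, X n -> X n -> Prop) :
    {n & X n} -> {n & X n} -> Prop :=
  | join_le_same n (x y : X n) :
      le n x y -> join_le le (existT X n x) (existT X n y)
  | join_le_lt i j (x : X i) (y : X j) :
      (i < j)%N -> join_le le (existT X i x) (existT X j y).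

Definition infinite_join (X : nat -> topologicalType) : topologicalType :=
  downset_space (join_le (fun n => @open_le (X n))).

Definition homotopic (R : realType) (T U : topologicalType) (f g : T -> U) :
    Prop :=
  exists H : T * R -> U,
    [/\ {within [set: T] `*` `[0, 1]%classic, continuous H},
        forall x, H (x, 0) = f x & forall x, H (x, 1) = g x].

Definition contractible (R : realType) (T : topologicalType) : Prop :=
  exists x0 : T, homotopic R (@idfun T) (cst x0).

(* Main.v *)
(** Choose p_n in X_n. The map sending X_n to the point p_(n+1) is continuous
    and lies above both the identity and the constant map p_0, so these two are
    homotopic: stay at the identity before time 1/2, sit at the upper map exactly
    at time 1/2, and at the constant map afterwards. *)

Require Import Defs.
From mathcomp Require Import all_boot all_order all_algebra.
From mathcomp Require Import all_classical all_reals all_analysis.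
Local Open Scope classical_set_scope.
Import Order.TTheory GRing.Theory Num.Theory numFieldNormedType.Exports.
Local Open Scope ring_scope.

Lemma open_downsetE (T : Type) (le : T -> T -> Prop)
    (U : set (downset_space le)) : open U = is_downset le U.
Proof. by []. Qed.

Lemma monotone_continuous (S T : Type) (leS : S -> S -> Prop)
    (leT : T -> T -> Prop) (f : downset_space leS -> downset_space leT) :
  (forall x y, leS x y -> leT (f x) (f y)) -> continuous f.
Proof.
move=> f_mono; apply/continuousP => U; rewrite !open_downsetE => dU x y xy.
exact/dU/f_mono.
Qed.

Lemma open_setX (S T : topologicalType) (A : set S) (B : set T) :
  open A -> open B -> open (A `*` B).
Proof.
move=> oA oB; rewrite openE => -[x y] [Ax By].
by exists (A, B) => //; split; exact: open_nbhs_nbhs.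
Qed.

(** Open sets are down-sets, so an open set containing [g x] also contains [f x] and [h x]. Taking
    the larger value [g x] at a single instant between the two regimes therefore keeps preimages
    open. *)
Lemma homotopic_upper_bound (R : realType) (S : topologicalType) (T : Type)
    (le : T -> T -> Prop) (f g h : S -> downset_space le) :
    continuous f -> continuous g -> continuous h ->
    (forall x, le (f x) (g x)) -> (forall x, le (h x) (g x)) ->
  homotopic R f h.
Proof.
move=> cf cg ch fg hg.
pose c : R := 2^-1.
pose H (z : S * R) : downset_space le :=
  if z.2 < c then f z.1 else if c < z.2 then h z.1 else g z.1.
exists H; split => [|x|x]; last 2 first.
- by rewrite /H /= invr_gt0 ltr0n.
- have c_lt1 : c < 1 by rewrite invf_lt1 ?ltr0n ?ltr1n.
  by rewrite /H /= c_lt1 ltNge (ltW c_lt1).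
apply: continuous_subspaceT; apply/continuousP => U oU.
have dU : is_downset le U by [].
(* If [g x] lies in [U], so does [H (x, t)] for every [t]: the middle box may use all times, which
   makes it open. *)
have -> : H @^-1` U = (f @^-1` U) `*` [set t | t < c]
    `|` (g @^-1` U) `*` setT `|` (h @^-1` U) `*` [set t | c < t].
  apply/seteqP; split=> -[x t]; rewrite /H /=.
    by case: ltgtP => _ Ux; [left; left|right|left; right].
  move=> [[[Uf ->]|[Ug _]]|[Uh ct]] //; last by rewrite ltNge (ltW ct) ct.
  by case: ltgtP => _ //; [exact: dU (fg x) Ug|exact: dU (hg x) Ug].
apply: openU; first apply: openU.
- by apply: open_setX; [move/continuousP: cf; exact|exact: open_lt].
- by apply: open_setX; [move/continuousP: cg; exact|exact: openT].
- by apply: open_setX; [move/continuousP: ch; exact|exact: open_gt].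
Qed.

Theorem theorem5p14 (R : realType) (X : nat -> topologicalType)
    (X_neq0 : forall n, [set: X n] !=set0)
    (X_finite : forall n, finite_set [set: X n])
    (X_T0 : forall n, kolmogorov_space (X n)) :
  contractible R (infinite_join X).
Proof.
pose le := join_le (fun n => @open_le (X n)).
pose p n : infinite_join X := existT X n (projT1 (cid (X_neq0 n))).
(* The successor puts [up x] in a strictly later summand than both [x] and [p 0], so the orders
   inside the summands do not matter for these comparisons. *)
pose up (x : infinite_join X) : infinite_join X := p (projT1 x).+1.
exists (p 0%N); apply: (homotopic_upper_bound R _ _ le _ up).
- by move=> x; exact: cvg_id.
(* Points of one summand have the same image, so reflexivity suffices; otherwise [i < j] gives
   [i.+1 < j.+1]. *)
- apply: monotone_continuous => x y; case=> [n a b _|i j a b ij].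
    exact: join_le_same.
  exact: join_le_lt.
- exact: cst_continuous.
- by case=> n a; exact: join_le_lt.
- by move=> x; exact: join_le_lt.
Qed.
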